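(* Let $$P_{4,3,7}(\mathbf{x},\mathbf{y}) = x_1^2y_1^2 + x_2^2y_2^2 + x_3^2y_3^2 + x_1^2y_2^2 + x_2^2y_3^2 + x_3^2y_1^2 + x_4^2y_1^2$$ and $$Q(\mathbf{x},\mathbf{y}) = P_{4,3,7}(\mathbf{x},\mathbf{y}) + (x_4y_2 + x_1y_3)^2,$$ regarded as $4\times 3$ biquadratic forms in the real variables $\mathbf{x}=(x_1,x_2,x_3,x_4)$ and $\mathbf{y}=(y_1,y_2,y_3)$. Then $\operatorname{sos}(Q)=8$. Consequently, $\operatorname{BSR}(4,3)\ge 8$.
   Context: An $m\times n$ biquadratic form in variables $\mathbf{x}=(x_1,\dots,x_m)$ and $\mathbf{y}=(y_1,\dots,y_n)$ is a polynomial $P(\mathbf{x},\mathbf{y})=\sum_{i,k=1}^{m}\sum_{j,l=1}^{n}a_{ijkl}\,x_ix_ky_jy_l$ with real coefficients. It is sum-of-squares (SOS) if it can be written as a finite sum of squares of real bilinear forms $\ell(\mathbf{x},\mathbf{y})=\sum_{i=1}^{m}\sum_{j=1}^{n}c_{ij}x_iy_j$. For an SOS form $P$, its SOS rank $\operatorname{sos}(P)$ is the smallest number of squares of bilinear forms in such a representation. $\operatorname{BSR}(m,n)$ denotes the maximum of $\operatorname{sos}(P)$ over all $m\times n$ SOS biquadratic forms $P$. *)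

(* Defs.v *)
From mathcomp Require Import all_boot all_order all_algebra.
From mathcomp Require Import classical_sets reals.
From mathcomp Require Import mpoly.

Set Implicit Arguments.
Unset Strict Implicit.
Unset Printing Implicit Defensive.

Import GRing.Theory.
Local Open Scope classical_set_scope.
Local Open Scope ring_scope.

(* The m + n indeterminates of {mpoly R[m + n]} are x_1, .., x_m followed by
   y_1, .., y_n. *)
Definition xvar (R : realType) (m n : nat) (i : 'I_m) : {mpoly R[m + n]} :=
  'X_(lshift n i).

Definition yvar (R : realType) (m n : nat) (j : 'I_n) : {mpoly R[m + n]} :=
  'X_(rshift m j).

Definition biquadratic (R : realType) (m n : nat) (P : {mpoly R[m + n]}) :
    Prop :=
  exists a : 'I_m -> 'I_n -> 'I_m -> 'I_n -> R,
    P = \sum_(i < m) \sum_(k < m) \sum_(j < n) \sum_(l < n)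
          a i j k l *: (xvar R n i * xvar R n k * yvar R m j * yvar R m l).

Definition bilinear_form (R : realType) (m n : nat) (c : 'M[R]_(m, n)) :
    {mpoly R[m + n]} :=
  \sum_(i < m) \sum_(j < n) c i j *: (xvar R n i * yvar R m j).

Definition sum_of_squares (R : realType) (m n : nat) (P : {mpoly R[m + n]})
    (r : nat) : Prop :=
  exists c : 'I_r -> 'M[R]_(m, n), P = \sum_(s < r) bilinear_form (c s) ^+ 2.

Definition sos_form (R : realType) (m n : nat) (P : {mpoly R[m + n]}) : Prop :=
  biquadratic P /\ exists r, sum_of_squares P r.

(* [xget 0 A] is an element of A if there is one, and 0 otherwise; each set
   below has at most one element. The default is taken only when P is not a
   sum of squares, resp. when the maximum does not exist, so a positive value
   (or lower bound) is never an artefact of it. *)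
Definition sos_rank (R : realType) (m n : nat) (P : {mpoly R[m + n]}) : nat :=
  xget 0%N [set r | sum_of_squares P r /\
                    forall r', sum_of_squares P r' -> (r <= r')%N].

Definition BSR (R : realType) (m n : nat) : nat :=
  xget 0%N [set b | (exists2 P : {mpoly R[m + n]},
                       sos_form P & sos_rank P = b) /\
                    forall P : {mpoly R[m + n]},
                      sos_form P -> (sos_rank P <= b)%N].

(* Indices start at 1 here; [inord k.-1] is the ordinal of value k - 1. *)
Definition P437 (R : realType) : {mpoly R[4 + 3]} :=
  let x (k : nat) := xvar R 3 (inord k.-1 : 'I_4) in
  let y (k : nat) := yvar R 4 (inord k.-1 : 'I_3) in
  x 1%N ^+ 2 * y 1%N ^+ 2 + x 2%N ^+ 2 * y 2%N ^+ 2 + x 3%N ^+ 2 * y 3%N ^+ 2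
  + x 1%N ^+ 2 * y 2%N ^+ 2 + x 2%N ^+ 2 * y 3%N ^+ 2
  + x 3%N ^+ 2 * y 1%N ^+ 2 + x 4%N ^+ 2 * y 1%N ^+ 2.

Definition Q43 (R : realType) : {mpoly R[4 + 3]} :=
  let x (k : nat) := xvar R 3 (inord k.-1 : 'I_4) in
  let y (k : nat) := yvar R 4 (inord k.-1 : 'I_3) in
  P437 R + (x 4%N * y 2%N + x 1%N * y 3%N) ^+ 2.

(* Main.v *)
Require Import Defs.
From HB Require Import structures.
From mathcomp Require Import all_boot all_order all_algebra.
From mathcomp Require Import boolp classical_sets reals.
From mathcomp Require Import mpoly ring.

Set Implicit Arguments.
Unset Strict Implicit.
Unset Printing Implicit Defensive.

Import Order.TTheory GRing.Theory Num.Theory.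

(** Write a representation of a form as a sum of r squares as a family of
    matrices c_1, .., c_r, and collect the coefficients of each x_i y_j into
    the vector v_ij = (c_s i j)_s of R^r. The form determines exactly the sums
    <v_ij, v_kl> + <v_il, v_kj>: they are its coefficients, up to a factor
    ([symmetrised_gram_unique]).

    For Q this forces eight of the v_ij to be orthonormal, whence r >= 8. The
    coefficients of the squares of x_2 y_1, x_3 y_2 and x_4 y_3 vanish, so
    v_21 = v_32 = v_43 = 0. The vectors v_42 and v_13 have norm 1, and
    <v_42, v_13> + <v_43, v_12> = 1 with v_43 = 0, so v_42 = v_13. The seven
    cells of P_{4,3,7} together with (4, 2) carry unit vectors. Two cells in a
    common row or column are orthogonal because their symmetrised sum is
    2 <v_ij, v_kl> and vanishes. Since v_42 = v_13, this also makes v_42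
    orthogonal to v_11, v_23 and v_33. For the remaining pairs of cells (i, j)
    and (k, l), the exchanged product <v_il, v_kj> vanishes, because one of
    its factors is null or because v_42 = v_13 makes it one of the products
    already treated; hence <v_ij, v_kl> vanishes too
    ([squares_of_Q43_geq8]). The definition of Q gives 8 squares.

    For BSR one also needs that the maximum exists, i.e. that the SOS rank of
    m x n forms is bounded. As soon as there are more than mn squares, the
    bilinear forms are linearly dependent, and a dependency allows one square
    to be absorbed into the others ([sum_of_squares_drop]); so the rank is at
    most mn. *)

(** * Sums of squares of bilinear forms: bounds on the number of squares *)

Section Forms.
Local Open Scope classical_set_scope.
Local Open Scope ring_scope.
Variables (R : realType) (m n : nat).
Implicit Types (P : {mpoly R[m + n]}) (c d : 'M[R]_(m, n)).

Lemma bilinear_form_is_linear : linear (@bilinear_form R m n).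
Proof.
move=> a c d; rewrite /bilinear_form scaler_sumr -big_split /=.
apply: eq_bigr => i _; rewrite scaler_sumr -big_split /=.
by apply: eq_bigr => j _; rewrite !mxE scalerDl scalerA.
Qed.

HB.instance Definition _ := GRing.isLinear.Build R 'M[R]_(m, n)
  {mpoly R[m + n]} _ (@bilinear_form R m n) bilinear_form_is_linear.

Lemma bilinear_form_sqr c :
  bilinear_form c ^+ 2 =
  \sum_(i < m) \sum_(k < m) \sum_(j < n) \sum_(l < n)
     (c i j * c k l) *: (xvar R n i * xvar R n k * yvar R m j * yvar R m l).
Proof.
rewrite expr2 {1}/bilinear_form mulr_suml; apply: eq_bigr => i _.
rewrite mulr_suml exchange_big /=.
transitivity (\sum_(j < n) \sum_(k < m) \sum_(l < n) (c i j * c k l) *: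
    (xvar R n i * xvar R n k * yvar R m j * yvar R m l)).
  apply: eq_bigr => j _; rewrite /bilinear_form mulr_sumr.
  apply: eq_bigr => k _; rewrite mulr_sumr; apply: eq_bigr => l _.
  rewrite -scalerAl -scalerAr scalerA; congr (_ *: _).
  by rewrite mulrACA !mulrA.
by rewrite exchange_big.
Qed.

Lemma sum_of_squares_biquadratic P r : sum_of_squares P r -> biquadratic P.
Proof.
case=> c ->; exists (fun i j k l => \sum_(s < r) c s i j * c s k l).
under eq_bigr => s _ do rewrite bilinear_form_sqr.
do 4![rewrite [LHS]exchange_big /=; apply: eq_bigr => ? _].
by rewrite scaler_suml.
Qed.

(** With L_s the bilinear forms, v the last coefficient of the dependency u
    and q ^ 2 the sum of the u_s ^ 2, replace L_s by L_s + a u_s L_max for the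
    other indices s. The dependency turns the cross terms into a multiple of
    L_max ^ 2, so the sum of squares is kept if
    a ^ 2 (q ^ 2 - v ^ 2) - 2 a v = 1, which a = 1 / (q - v) solves; v <= 0
    makes the denominator positive. *)
Lemma sum_of_squares_drop (r : nat) (c : 'I_r.+1 -> 'M[R]_(m, n))
    (u : 'I_r.+1 -> R) :
  \sum_s u s *: c s = 0 -> u ord_max <= 0 -> (exists s, u s != 0) ->
  sum_of_squares (\sum_s bilinear_form (c s) ^+ 2) r.
Proof.
move=> u_dep u_max [s0 us0].
pose N := \sum_s u s ^+ 2.
have N_gt0 : 0 < N.
  rewrite /N (bigD1 s0) //= ltr_pwDl ?exprn_even_gt0 ?us0 ?orbT //.
  by rewrite sumr_ge0 // => s _; rewrite sqr_ge0.
pose q := Num.sqrt N; pose v := u ord_max; pose a := (q - v)^-1.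
have qv_neq0 : q - v != 0.
  by rewrite gt_eqF // ltr_wpDr ?sqrtr_gt0 // oppr_ge0.
have a_eq : a ^+ 2 * (q ^+ 2 - v ^+ 2) - 2 * a * v = 1.
  by rewrite /a; field.
pose w (s : 'I_r) : 'I_r.+1 := widen_ord (leqnSn r) s.
exists (fun s => c (w s) + (a * u (w s)) *: c ord_max).
pose L s := bilinear_form (c s).
have L_dep : \sum_(s < r) u (w s) *: L (w s) = - (v *: L ord_max).
  apply/eqP; rewrite -addr_eq0; apply/eqP.
  have := congr1 (@bilinear_form R m n) u_dep.
  rewrite linear0 linear_sum big_ord_recr /= linearZ /= => u_lin.
  rewrite -[RHS]u_lin; congr (_ + _).
  by apply: eq_bigr => s _; rewrite linearZ.
have u_sqr : \sum_(s < r) u (w s) ^+ 2 = q ^+ 2 - v ^+ 2.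
  by rewrite sqr_sqrtr ?ltW // /N big_ord_recr /= addrK.
rewrite big_ord_recr /=.
transitivity (\sum_(s < r) (L (w s) ^+ 2 +
    ((2 * a) *: L ord_max) * (u (w s) *: L (w s)) +
    u (w s) ^+ 2 *: (a ^+ 2 *: L ord_max ^+ 2))); last first.
  apply: eq_bigr => s _.
  have -> : bilinear_form (c (w s) + (a * u (w s)) *: c ord_max) =
      L (w s) + (a * u (w s)) *: L ord_max by rewrite linearD linearZ.
  by rewrite -!mul_mpolyC !rmorphXn !rmorphM /= rmorph_nat; ring.
rewrite !big_split /= -mulr_sumr -scaler_suml L_dep u_sqr -addrA.
congr (_ + _); rewrite -/(L _) mulrN -scalerAl -scalerAr -expr2 !scalerA.
by rewrite -scaleNr -scalerDl addrC mulrC a_eq scale1r.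
Qed.

(** A dependency exists by dimension count in the mn-dimensional space of
    matrices; its sign is free, so its last coefficient may be taken
    nonpositive. *)
Lemma sum_of_squares_pred P r : (m * n <= r)%N ->
  sum_of_squares P r.+1 -> sum_of_squares P r.
Proof.
move=> le_r [c ->].
pose C : 'M[R]_(r.+1, m * n) := \matrix_s mxvec (c s).
have /rowV0Pn[u /sub_kermxP uC u_neq0] : kermx C != 0.
  by rewrite kermx_eq0 /row_free neq_ltn (leq_ltn_trans (rank_leq_col C)).
have u_dep : \sum_s u 0 s *: c s = 0.
  apply: (can_inj mxvecK); rewrite linear0 linear_sum -[RHS]uC mulmx_sum_row.
  by apply: eq_bigr => s _; rewrite linearZ rowK.
have u_ex : exists s, u 0 s != 0.
  by have [s] := rV0Pn _ u_neq0; exists s.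
have [u_le0 | u_gt0] := lerP (u 0 ord_max) 0.
  exact: (sum_of_squares_drop u_dep).
apply: (@sum_of_squares_drop _ c (fun s => - u 0 s)).
- by under eq_bigr do rewrite scaleNr; rewrite sumrN u_dep oppr0.
- by rewrite oppr_le0 ltW.
- by have [s us] := u_ex; exists s; rewrite oppr_eq0.
Qed.

Lemma sum_of_squares_leq P r :
  sum_of_squares P r -> exists2 r', (r' <= m * n)%N & sum_of_squares P r'.
Proof.
elim: r => [|r IHr] Pr; first by exists 0.
have [le_r | lt_r] := leqP (m * n) r; last by exists r.+1.
exact: IHr (sum_of_squares_pred le_r Pr).
Qed.

Lemma sos_rank_spec P : (exists r, sum_of_squares P r) ->
  sum_of_squares P (sos_rank P) /\
  forall r, sum_of_squares P r -> (sos_rank P <= r)%N.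
Proof.
move=> [r0 Pr0].
have Pex : exists r, `[< sum_of_squares P r >] by exists r0; apply/asboolP.
case: (ex_minnP Pex) => r /asboolP Pr r_min.
rewrite /sos_rank; set A := [set _ | _]; suff: A (xget 0%N A) by [].
apply: xgetPex; exists r; split=> // r' Pr'.
by apply: r_min; apply/asboolP.
Qed.

Lemma sos_rank_eq P r : sum_of_squares P r ->
  (forall r', sum_of_squares P r' -> (r <= r')%N) -> sos_rank P = r.
Proof.
move=> Pr r_min; have [Ps s_min] := sos_rank_spec (ex_intro _ r Pr).
by apply/eqP; rewrite eqn_leq s_min // r_min.
Qed.

(** The bound mn on the SOS rank shows that the maximum is attained, so that
    BSR is not the default value of its definition. *)
Lemma sos_rank_leq_BSR P : sos_form P -> (sos_rank P <= BSR R m n)%N.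
Proof.
move=> P_sos.
pose hit b := `[< exists2 P, sos_form P & @sos_rank R m n P = b >].
have hit_ex : exists b, hit b by exists (sos_rank P); apply/asboolP; exists P.
have hit_bounded b : hit b -> (b <= m * n)%N.
  case/asboolP=> P' [_ P'_sos] <-; have [r Pr] := P'_sos.
  have [r' le_r' Pr'] := sum_of_squares_leq Pr.
  exact: leq_trans ((sos_rank_spec P'_sos).2 _ Pr') le_r'.
case: (ex_maxnP hit_ex hit_bounded) => b /asboolP b_hit b_max.
suff [_] : (exists2 P, sos_form P & @sos_rank R m n P = BSR R m n) /\
    forall P, sos_form P -> (@sos_rank R m n P <= BSR R m n)%N by apply.
rewrite /BSR; set A := [set _ | _]; suff: A (xget 0%N A) by [].
apply: xgetPex; exists b; split=> // P' P'_sos.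
by apply: b_max; apply/asboolP; exists P'.
Qed.

(** * The symmetrised Gram matrix of a representation *)

Definition join_point (x : 'I_m -> R) (y : 'I_n -> R) (h : 'I_(m + n)) : R :=
  match split h with inl i => x i | inr j => y j end.

Definition bilinear_value c (x : 'I_m -> R) (y : 'I_n -> R) : R :=
  \sum_(i < m) \sum_(j < n) c i j * (x i * y j).

Lemma meval_bilinear_form c x y :
  (bilinear_form c).@[join_point x y] = bilinear_value c x y.
Proof.
rewrite /bilinear_form raddf_sum; apply: eq_bigr => i _ /=.
rewrite raddf_sum; apply: eq_bigr => j _ /=.
rewrite mevalZ mevalM !mevalXU /join_point.
by rewrite (unsplitK (inl i : 'I_m + 'I_n)) (unsplitK (inr j : 'I_m + 'I_n)).
Qed.

Lemma bilinear_valueDl c x x' y :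
  bilinear_value c (x \+ x') y = bilinear_value c x y + bilinear_value c x' y.
Proof.
rewrite -big_split; apply: eq_bigr => i _ /=; rewrite -big_split.
by apply: eq_bigr => j _ /=; ring.
Qed.

Lemma bilinear_valueDr c x y y' :
  bilinear_value c x (y \+ y') = bilinear_value c x y + bilinear_value c x y'.
Proof.
rewrite -big_split; apply: eq_bigr => i _ /=; rewrite -big_split.
by apply: eq_bigr => j _ /=; ring.
Qed.

Definition basis_vec (p : nat) (i k : 'I_p) : R := (k == i)%:R.

Lemma bilinear_value_basis c i j :
  bilinear_value c (basis_vec i) (basis_vec j) = c i j.
Proof.
rewrite /bilinear_value (bigD1 i) //= (bigD1 j) //= /basis_vec !eqxx !mulr1.
rewrite [X in _ + X + _]big1 => [|l /negPf->]; last by rewrite !mulr0.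
rewrite [X in _ + X]big1 ?addr0 // => k /negPf->.
by rewrite big1 // => l _; rewrite mul0r mulr0.
Qed.

(** The second difference in x and in y, which isolates the part of a
    biquadratic form that is linear in each of x, x', y, y'. *)
Definition polarization (f : ('I_m -> R) -> ('I_n -> R) -> R) x x' y y' : R :=
  let fy x := f x (y \+ y') - f x y - f x y' in fy (x \+ x') - fy x - fy x'.

Definition gram r (c : 'I_r -> 'M[R]_(m, n)) (i : 'I_m) (j : 'I_n)
    (k : 'I_m) (l : 'I_n) : R := \sum_(s < r) c s i j * c s k l.

Lemma gramC r (c : 'I_r -> 'M[R]_(m, n)) i j k l :
  gram c i j k l = gram c k l i j.
Proof. by apply: eq_bigr => s _; rewrite mulrC. Qed.

Lemma polarization_sos r (c : 'I_r -> 'M[R]_(m, n)) i j k l :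
  polarization
    (fun x y => (\sum_(s < r) bilinear_form (c s) ^+ 2).@[join_point x y])
    (basis_vec i) (basis_vec k) (basis_vec j) (basis_vec l) =
  2 * (gram c i j k l + gram c i l k j).
Proof.
have evalE x y : (\sum_(s < r) bilinear_form (c s) ^+ 2).@[join_point x y] =
    \sum_(s < r) bilinear_value (c s) x y ^+ 2.
  rewrite raddf_sum; apply: eq_bigr => s _ /=.
  by rewrite rmorphXn /= meval_bilinear_form.
rewrite /polarization !evalE /gram -!sumrB -big_split mulr_sumr /=.
apply: eq_bigr => s _.
by rewrite !(bilinear_valueDl, bilinear_valueDr, bilinear_value_basis); ring.
Qed.

(** The symmetrised sums are half the polarization of the form, which does not
    depend on the representation. Single Gram entries do depend on it, as
    x_i y_j * x_k y_l and x_i y_l * x_k y_j are the same monomial. *)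
Lemma symmetrised_gram_unique r r' (c : 'I_r -> 'M[R]_(m, n))
    (d : 'I_r' -> 'M[R]_(m, n)) i j k l :
  \sum_s bilinear_form (c s) ^+ 2 = \sum_s bilinear_form (d s) ^+ 2 ->
  gram c i j k l + gram c i l k j = gram d i j k l + gram d i l k j.
Proof.
move=> eq_cd; have := polarization_sos c i j k l.
by rewrite eq_cd polarization_sos => /(mulfI _)-> //; rewrite pnatr_eq0.
Qed.

Lemma gram_diag0 r (c : 'I_r -> 'M[R]_(m, n)) i j :
  gram c i j i j = 0 -> forall s, c s i j = 0.
Proof.
move=> /eqP; rewrite psumr_eq0 => [/allP c0 s|s _]; last first.
  by rewrite -expr2 sqr_ge0.
by have := c0 s (mem_index_enum s); rewrite /= mulf_eq0 orbb => /eqP.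
Qed.

(** The selected vectors are the rows of a t x r matrix V with V V^T = 1. *)
Lemma gram_orthonormal_leq r (c : 'I_r -> 'M[R]_(m, n)) t
    (p : 'I_t -> 'I_m * 'I_n) :
  (forall a b, gram c (p a).1 (p a).2 (p b).1 (p b).2 = (a == b)%:R) ->
  (t <= r)%N.
Proof.
move=> orth; pose V := \matrix_(a < t, s < r) c s (p a).1 (p a).2.
apply: (@mulmx1_min R t r V V^T); apply/matrixP => a b.
by rewrite !mxE -orth; apply: eq_bigr => s _; rewrite !mxE.
Qed.

Definition indicator (A : seq ('I_m * 'I_n)) : 'M[R]_(m, n) :=
  \matrix_(i, j) ((i, j) \in A)%:R.

Lemma bilinear_form_indicator A : uniq A ->
  bilinear_form (indicator A) = \sum_(p <- A) xvar R n p.1 * yvar R m p.2.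
Proof.
move=> A_uniq; rewrite big_uniq //= big_mkcond /= /bilinear_form.
rewrite pair_bigA; apply: eq_bigr => -[i j] _ /=; rewrite mxE.
by case: ifP; rewrite ?scale1r ?scale0r.
Qed.

End Forms.

(** * The form Q and its eight squares *)

Section TheFormQ.
Local Open Scope ring_scope.
Variable R : realType.

(* Explicit proofs of the bounds, unlike [inord], let the finite checks below
   be done by computation. *)
Let x1 : 'I_4 := Ordinal (isT : 0 < 4)%N.
Let x2 : 'I_4 := Ordinal (isT : 1 < 4)%N.
Let x3 : 'I_4 := Ordinal (isT : 2 < 4)%N.
Let x4 : 'I_4 := Ordinal (isT : 3 < 4)%N.
Let y1 : 'I_3 := Ordinal (isT : 0 < 3)%N.
Let y2 : 'I_3 := Ordinal (isT : 1 < 3)%N.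
Let y3 : 'I_3 := Ordinal (isT : 2 < 3)%N.

Definition supportsQ : seq (seq ('I_4 * 'I_3)) :=
  [:: [:: (x1, y1)]; [:: (x2, y2)]; [:: (x3, y3)]; [:: (x1, y2)];
      [:: (x2, y3)]; [:: (x3, y1)]; [:: (x4, y1)]; [:: (x4, y2); (x1, y3)]].

Definition squareQ (s : 'I_8) : 'M[R]_(4, 3) :=
  indicator R (nth [::] supportsQ s).

Lemma Q43_eq : Q43 R = \sum_(s < 8) bilinear_form (squareQ s) ^+ 2.
Proof.
have xE k (lt_k : (k < 4)%N) : inord k = Ordinal lt_k :> 'I_4.
  by apply: val_inj; rewrite /= inordK.
have yE k (lt_k : (k < 3)%N) : inord k = Ordinal lt_k :> 'I_3.
  by apply: val_inj; rewrite /= inordK.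
rewrite !big_ord_recr big_ord0 /= add0r /squareQ /=.
rewrite !bilinear_form_indicator // !big_cons !big_nil !addr0 !exprMn.
by rewrite /Q43 /P437 /= !xE !yE.
Qed.

(** A natural number version of <v_p, v_q> + <v_p', v_q'>, where p' and q' are
    p and q with their columns exchanged, so that its values on cells can be
    computed. *)
Definition symgramQ (p q : 'I_4 * 'I_3) : nat :=
  sumn [seq ((p \in A) * (q \in A) +
             ((p.1, q.2) \in A) * ((q.1, p.2) \in A))%N | A <- supportsQ].

Lemma gram_squareQ p q :
  gram squareQ p.1 p.2 q.1 q.2 + gram squareQ p.1 q.2 q.1 p.2 =
  (symgramQ p q)%:R.
Proof.
rewrite /symgramQ sumnE big_map natr_sum (big_nth [::]) big_mkord.
rewrite /gram -big_split; apply: eq_bigr => s _.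
by rewrite /squareQ !mxE natrD !natrM -!surjective_pairing.
Qed.

(** * Orthogonality forced by the coefficients of Q *)

(** The diagonal sum is 2 |v_p| ^ 2, hence v_p = 0 in every representation. *)
Definition nullQ (p : 'I_4 * 'I_3) : bool := symgramQ p p == 0%N.

(** Cases where the symmetrised sum alone forces <v_p, v_q> = 0: in a common
    row or column it is 2 <v_p, v_q>; otherwise the exchanged product is
    killed by a null vector. *)
Definition orthQ (p q : 'I_4 * 'I_3) : bool :=
  (symgramQ p q == 0%N) &&
  [|| p.1 == q.1, p.2 == q.2, nullQ (p.1, q.2) | nullQ (q.1, p.2)].

(** The cells (4, 2) and (1, 3) of the square (x_4 y_2 + x_1 y_3) ^ 2 carry
    the same vector in every representation. *)
Definition twinQ (p : 'I_4 * 'I_3) : 'I_4 * 'I_3 :=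
  if p == (x4, y2) then (x1, y3) else if p == (x1, y3) then (x4, y2) else p.

Definition orth_twinQ p q : bool :=
  [|| orthQ p q, orthQ (twinQ p) q | orthQ p (twinQ q)].

Definition orth_exchangeQ (p q : 'I_4 * 'I_3) : bool :=
  orth_twinQ p q ||
  (symgramQ p q == 0%N) && orth_twinQ (p.1, q.2) (q.1, p.2).

(** One cell for each square of Q; the last square is represented by (4, 2),
    its twin (1, 3) carrying the same vector. *)
Definition cellsQ : seq ('I_4 * 'I_3) := [seq head (x1, y1) A | A <- supportsQ].

Lemma cellsQ_orth :
  all (fun p => all (fun q => (p == q) || orth_exchangeQ p q) cellsQ) cellsQ.
Proof. by vm_compute. Qed.

Lemma cellsQ_unit : all (fun p => symgramQ p p == 2) cellsQ.
Proof. by vm_compute. Qed.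

Section GramOfARepresentation.
Variables (r : nat) (c : 'I_r -> 'M[R]_(4, 3)).
Hypothesis Qc : Q43 R = \sum_s bilinear_form (c s) ^+ 2.

Let G (p q : 'I_4 * 'I_3) : R := gram c p.1 p.2 q.1 q.2.

Lemma symgramE p q : G p q + G (p.1, q.2) (q.1, p.2) = (symgramQ p q)%:R.
Proof.
by rewrite -gram_squareQ; apply: symmetrised_gram_unique; rewrite -Qc Q43_eq.
Qed.

Lemma gram_cell p : symgramQ p p = 2 -> G p p = 1.
Proof.
move=> p2; have := symgramE p p; rewrite -surjective_pairing p2 -mulr2n.
move=> G2; apply: (@mulIf _ 2); first by rewrite pnatr_eq0.
by rewrite mul1r mulr_natr.
Qed.

Lemma null_coef p : nullQ p -> forall s, c s p.1 p.2 = 0.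
Proof.
move=> /eqP p0; apply: gram_diag0; apply/eqP.
have := symgramE p p; rewrite -surjective_pairing p0 => /eqP.
by rewrite -mulr2n mulrn_eq0.
Qed.

Lemma orth_gram p q : orthQ p q -> G p q = 0.
Proof.
case/andP=> /eqP pq0 why; have := symgramE p q; rewrite pq0.
have double0 (a : R) : a + a = 0 -> a = 0.
  by move/eqP; rewrite -mulr2n mulrn_eq0 => /eqP.
case/or4P: why => [/eqP p1 | /eqP p2 | nul | nul].
- by rewrite {2}/G /= gramC -p1 {2}p1; apply: double0.
- by rewrite {2}/G /= -p2 {2}p2; apply: double0.
- suff -> : G (p.1, q.2) (q.1, p.2) = 0 by rewrite addr0.
  by apply: big1 => s _; rewrite [c s _ _](null_coef nul) mul0r.
- suff -> : G (p.1, q.2) (q.1, p.2) = 0 by rewrite addr0.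
  by apply: big1 => s _; rewrite [c s q.1 _](null_coef nul) mulr0.
Qed.

(** Both vectors have norm 1, and their inner product is 1, since the
    exchanged product involves the null vector of (4, 3): this is the equality
    case of the Cauchy-Schwarz inequality. *)
Lemma twin_coef s : c s x4 y2 = c s x1 y3.
Proof.
have w1 : G (x4, y2) (x4, y2) = 1 by apply: gram_cell; vm_compute.
have w2 : G (x1, y3) (x1, y3) = 1 by apply: gram_cell; vm_compute.
have w12 : G (x4, y2) (x1, y3) = 1.
  have := symgramE (x4, y2) (x1, y3).
  rewrite [symgramQ _ _](_ : _ = 1%N); last by vm_compute.
  suff -> : G (x4, y3) (x1, y2) = 0 by rewrite addr0.
  have null43 : nullQ (x4, y3) by vm_compute.
  by apply: big1 => s' _; rewrite [c s' _ _](null_coef null43) mul0r.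
have /eqP : \sum_s (c s x4 y2 - c s x1 y3) ^+ 2 = 0.
  transitivity (G (x4, y2) (x4, y2) - 2 * G (x4, y2) (x1, y3)
                + G (x1, y3) (x1, y3)); last by rewrite w1 w2 w12; ring.
  rewrite /G /gram mulr_sumr -sumrB -big_split.
  by apply: eq_bigr => s' _ /=; ring.
rewrite psumr_eq0 => [/allP/(_ s (mem_index_enum s))|? _].
  by rewrite /= sqrf_eq0 subr_eq0 => /eqP.
by rewrite sqr_ge0.
Qed.

Lemma twinE p s : c s (twinQ p).1 (twinQ p).2 = c s p.1 p.2.
Proof.
rewrite /twinQ; case: eqP => [->|_]; first by rewrite twin_coef.
by case: eqP => [->|_ //]; rewrite twin_coef.
Qed.

Lemma orth_twin_gram p q : orth_twinQ p q -> G p q = 0.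
Proof.
case/or3P=> /orth_gram // <-; apply: eq_bigr => s _; by rewrite twinE.
Qed.

Lemma orth_exchange_gram p q : orth_exchangeQ p q -> G p q = 0.
Proof.
case/orP=> [/orth_twin_gram // | /andP[/eqP pq0 /orth_twin_gram ex0]].
by have := symgramE p q; rewrite pq0 ex0 addr0.
Qed.

Lemma squares_of_Q43_geq8 : (8 <= r)%N.
Proof.
apply: (@gram_orthonormal_leq R 4 3 r c 8 (fun a => nth (x1, y1) cellsQ a)).
move=> a b; rewrite -/(G _ _).
have cell (s : 'I_8) : nth (x1, y1) cellsQ s \in cellsQ by rewrite mem_nth.
have [<-|neq_ab] := eqVneq a b.
  by apply: gram_cell; apply/eqP; exact: (allP cellsQ_unit).
have := allP (allP cellsQ_orth _ (cell a)) _ (cell b).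
rewrite nth_uniq // -/(_ == b) val_eqE (negPf neq_ab) /=.
exact: orth_exchange_gram.
Qed.

End GramOfARepresentation.

Lemma Q43_sum_of_8_squares : sum_of_squares (m := 4) (n := 3) (Q43 R) 8.
Proof. by exists squareQ; exact: Q43_eq. Qed.

End TheFormQ.

Theorem theorem4p1 (R : realType) :
  [/\ sos_form (m := 4) (n := 3) (Q43 R),
      sos_rank (m := 4) (n := 3) (Q43 R) = 8
    & 8 <= BSR R 4 3].
Proof.
have Q8 := Q43_sum_of_8_squares R.
have Q_sos : sos_form (m := 4) (n := 3) (Q43 R).
  by split; [exact: sum_of_squares_biquadratic Q8 | exists 8].
have rankQ : sos_rank (m := 4) (n := 3) (Q43 R) = 8.
  by apply: sos_rank_eq Q8 _ => r [c Qc]; exact: squares_of_Q43_geq8 Qc.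
by split=> //; rewrite -[leqLHS]rankQ; exact: sos_rank_leq_BSR.
Qed.
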